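(* Let $S$ be an integral domain that is not a field, let $F$ be its field of fractions, let $A \neq F$ be an $F$-algebra, and let $\mathbb{S}$ be the set of all $S$-nice subalgebras of $A$, assumed nonempty, endowed with the topology described in the context and partially ordered by inclusion. Let $U \subseteq \mathbb{S}$ be a nonempty open set. The following statements are equivalent: (a) $U$ has a greatest element. (b) There exists $R_0 \in \mathbb{S}$ such that $\mathrm{cl}\, U = \mathrm{cl}\{R_0\}$. (c) $U$ has a unique maximal element. (d) $U$ is irreducible. (e) $U$ is a sup subsemilattice of $\mathbb{S}$. (f) Every nonempty subset $H \subseteq U$ has a supremum (in $\mathbb{S}$).
   Context: Algebras are associative and unital, not necessarily commutative, and $F$ is identified with its image in $A$. An $S$-subalgebra $R$ of $A$ is called $S$-nice if $R \cap F = S$ and $FR = A$ (where $FR$ is the set of finite sums $\sum t_i r_i$, $t_i \in F$, $r_i \in R$). For $M \subseteq A$ let $V(M)$ be the set of all $S$-nice subalgebras of $A$ containing $M$. The sets $V(M)$, $M \subseteq A$, form a basis of the topology on $\mathbb{S}$; equivalently, a subset of $\mathbb{S}$ is open iff it is an upper set with respect to inclusion, and closed iff it is a lower set with respect to inclusion. $\mathrm{cl}$ denotes closure in $\mathbb{S}$. A subset $I$ of a topological space is irreducible if it is nonempty and whenever $I \subseteq G_1 \cup G_2$ with $G_1, G_2$ closed, then $I \subseteq G_1$ or $I \subseteq G_2$. A sup semilattice is a poset in which every two elements have a supremum; a subset of a poset $P$ is a sup subsemilattice of $P$ if it is a sup semilattice with respect to the partial order of $P$. *)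

(* Defs.v *)
From HB Require Import structures.
From mathcomp Require Import all_boot all_order all_algebra.
From mathcomp Require Import all_classical all_reals all_analysis.

Set Implicit Arguments.
Unset Strict Implicit.
Unset Printing Implicit Defensive.

Import Order.TTheory GRing.Theory.
Import SetOrder.Exports.

Local Open Scope classical_set_scope.
Local Open Scope ring_scope.

Notation "x %:F" := (@FracField.tofrac _ x) : ring_scope.

Section NiceSubalgebras.
Context {S : idomainType} {A : algType {fraction S}}.

(* A is an S-algebra by restriction of scalars along S -> {fraction S}. *)
Definition is_subalgebra (R : set A) : Prop :=
  [/\ R 1,
      (forall x y, R x -> R y -> R (x - y)),
      (forall x y, R x -> R y -> R (x * y)) &
      (forall (s : S) x, R x -> R (s%:F *: x))].

(* The algebra A is nontrivial, so t |-> t%:A embeds {fraction S} in A. *)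
Definition base_field : set A := range (fun t : {fraction S} => t%:A).
Definition base_ring : set A := range (fun s : S => s%:F%:A).

(* The set FR of finite sums of t_i r_i with t_i in F and r_i in R. *)
Definition field_span (R : set A) : set A :=
  [set a | exists (n : nat) (t : 'I_n -> {fraction S}) (r : 'I_n -> A),
    (forall i, R (r i)) /\ a = \sum_(i < n) t i *: r i].

Definition is_nice (R : set A) : Prop :=
  [/\ is_subalgebra R, R `&` base_field = base_ring & field_span R = setT].

End NiceSubalgebras.

Record niceSubalg (S : idomainType) (A : algType {fraction S}) := NiceSubalg {
  nice_set :> set A;
  nice_setP : `[< is_nice nice_set >] }.

Section NicePoset.
Context {S : idomainType} {A : algType {fraction S}}.

HB.instance Definition _ := [isSub for @nice_set S A].
HB.instance Definition _ := [Choice of niceSubalg A by <:].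
HB.instance Definition _ :=
  [SubChoice_isSubPOrder of niceSubalg A by <: with set_display].

Lemma le_niceE (R R' : niceSubalg A) :
  (R <= R')%O <-> (nice_set R `<=` nice_set R').
Proof. by rewrite -Order.le_val; split => /asboolP. Qed.

End NicePoset.

Section NiceTopology.
Context {S : idomainType} {A : algType {fraction S}}.

Definition niceV (M : set A) : set (niceSubalg A) := [set R | M `<=` R].

Let niceV_cover : \bigcup_(M in setT) niceV M = setT.
Proof. by rewrite -subTset => R _; exists set0 => // x. Qed.

Let niceV_join (M N : set A) (R : niceSubalg A) :
  [set: set A] M -> [set: set A] N -> niceV M R -> niceV N R ->
  exists K, [/\ [set: set A] K, niceV K R & niceV K `<=` niceV M `&` niceV N].
Proof.
move=> _ _ MR NR; exists (M `|` N); split => //.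
  by move=> x [/MR|/NR].
by move=> R' h; split=> x hx; apply: h; [left|right].
Qed.

HB.instance Definition _ :=
  isBaseTopological.Build (niceSubalg A) niceV_cover niceV_join.

End NiceTopology.

Definition irreducible_set {T : topologicalType} (I : set T) : Prop :=
  I !=set0 /\ forall G1 G2 : set T, closed G1 -> closed G2 ->
    I `<=` G1 `|` G2 -> I `<=` G1 \/ I `<=` G2.

Section Posets.
Context {d : Order.disp_t} {P : porderType d}.
Implicit Types (U H : set P) (m s : P).

Definition greatest U m : Prop := U m /\ ubound U m.

Definition maximal_in U m : Prop := U m /\ forall x, U x -> (m <= x)%O -> x = m.

(* Supremum of H computed in the subposet U, not in P. *)
Definition supremum_in U H s : Prop :=
  (U `&` ubound H) s /\ lbound (U `&` ubound H) s.

Definition sup_subsemilattice U : Prop :=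
  forall x y, U x -> U y -> exists s, supremum_in U [set x; y] s.

End Posets.

(* Main.v *)
Require Import Defs.
From HB Require Import structures.
From mathcomp Require Import all_boot all_order all_algebra.
From mathcomp Require Import all_classical all_reals all_analysis.

(** Two constructions stay inside the poset of nice subalgebras: the union of a
nonempty upward directed family ([nice_directed_bound]), and the intersection
of a nonempty family of nice subalgebras that all contain a common one
([bounded_isLub]). In both cases [R `&` F = S] passes to the union or to the
intersection, and [F R = A] holds because the result contains a nice
subalgebra. Hence every nonempty bounded family has a supremum, the
intersection of its upper bounds, and by Zorn's lemma every nice subalgebra
lies below a maximal one ([exists_maximal_above]).

The topology only sees the order: open sets are the upper sets, closed sets
the lower sets, and the closure of [U] is the set of elements below a member
of [U]. So a closure [closure [set R0]] is the set of subalgebras contained in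
[R0], which gives (a) => (b) => (c). If [U] has a unique maximal element, then
Zorn's lemma puts all of [U] below it, and a closed set that contains it
contains [U]; thus [U] is irreducible. If [U] is irreducible, two elements
[x], [y] of [U] have a common upper bound in [U], since otherwise the closed
sets of elements not above [x] and of elements not above [y] would cover [U];
the supremum of [x] and [y] then exists, and lies in the upper set [U]. If [U]
is a sup semilattice, it is directed, so it has an upper bound, and all its
nonempty subsets have suprema. Finally the supremum of [U] is above an element
of the upper set [U], so it belongs to [U] and is its greatest element. *)

Set Implicit Arguments.
Unset Strict Implicit.
Unset Printing Implicit Defensive.

Import Order.TTheory.

Local Open Scope classical_set_scope.
Local Open Scope ring_scope.

(** * Unions and intersections of nice subalgebras *)

Section NiceConstructions.
Context {S : idomainType} {A : algType {fraction S}}.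
Implicit Types (M N : set A) (R : niceSubalg A) (H : set (niceSubalg A)).

Lemma niceP R : is_nice (nice_set R).
Proof. exact/asboolP/nice_setP. Qed.

Lemma field_spanS M N : M `<=` N -> field_span M `<=` field_span N.
Proof.
move=> MN a [n [t [r [Mr ->]]]]; exists n, t, r; split => // i.
exact/MN/Mr.
Qed.

Lemma subalgebra_base_ring M : is_subalgebra M -> base_ring `<=` M.
Proof. by case=> M1 _ _ Mscale _ [s _ <-]; exact: Mscale. Qed.

(** A subalgebra contains [S] since it contains [1], and [F M = A] is inherited
from [R]; so only the inclusion of [M `&` F] in [S] has to be verified for the
unions and intersections below. *)
Lemma nice_above M R :
    is_subalgebra M -> nice_set R `<=` M -> M `&` base_field `<=` base_ring ->
  is_nice M.
Proof.
move=> Msub RM MF; split => //.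
- apply/seteqP; split => // a Sa; split; first exact: subalgebra_base_ring Sa.
  by case: Sa => s _ <-; exists s%:F.
- rewrite -subTset; have [_ _ <-] := niceP R; exact: field_spanS.
Qed.

Definition directed H : Prop :=
  forall x y, H x -> H y -> exists z, [/\ H z, (x <= z)%O & (y <= z)%O].

(** Sums and products stay in the union because any two elements of it lie in
a single member of [H]; each member meets [F] in [S], hence so does the
union. *)
Lemma nice_directed_bound H :
  H !=set0 -> directed H -> exists R, ubound H R.
Proof.
move=> [R HR] dirH; pose M := \bigcup_(X in H) nice_set X.
have Mnice : is_nice M.
  apply: (nice_above (R := R)).
  - split.
    + by exists R => //; have [[]] := niceP R.
    + move=> x y [X HX Xx] [Y HY Yy].
      have [Z [HZ /le_niceE XZ /le_niceE YZ]] := dirH _ _ HX HY.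
      have [[_ ZB _ _] _ _] := niceP Z.
      by exists Z => //; apply: ZB; [exact: XZ | exact: YZ].
    + move=> x y [X HX Xx] [Y HY Yy].
      have [Z [HZ /le_niceE XZ /le_niceE YZ]] := dirH _ _ HX HY.
      have [[_ _ ZM _] _ _] := niceP Z.
      by exists Z => //; apply: ZM; [exact: XZ | exact: YZ].
    + move=> s x [X HX Xx]; exists X => //.
      by have [[_ _ _ XZ] _ _] := niceP X; exact: XZ.
  - by move=> x Rx; exists R.
  - by move=> x [[X HX Xx] Fx]; have [_ <- _] := niceP X.
exists (NiceSubalg (asboolT Mnice)) => X HX.
by apply/le_niceE => x Xx; exists X.
Qed.

(** The supremum is the intersection of all the upper bounds; it is nice since
it lies between a member of [H] and [T]: the former makes it span [A], the
latter makes it meet [F] in [S]. *)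
Lemma bounded_isLub H T : H !=set0 -> ubound H T -> exists R, isLub H R.
Proof.
move=> [R HR] HT; pose M := \bigcap_(X in ubound H) nice_set X.
have Mnice : is_nice M.
  apply: (nice_above (R := R)).
  - split=> [X _|x y Mx My X HX|x y Mx My X HX|s x Mx X HX];
      have [[X1 XB XM XZ] _ _] := niceP X.
    + exact: X1.
    + by apply: XB; [exact: Mx | exact: My].
    + by apply: XM; [exact: Mx | exact: My].
    + exact/XZ/Mx.
  - by move=> x Rx X /(_ _ HR)/le_niceE; apply.
  - by move=> x [Mx Fx]; have [_ <- _] := niceP T; split => //; exact: Mx.
exists (NiceSubalg (asboolT Mnice)); split=> X HX; apply/le_niceE => x.
- by move=> Xx Y /(_ _ HX)/le_niceE; apply.
- exact.
Qed.

Lemma exists_maximal_above R :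
  exists2 m, (R <= m)%O & forall T, (m <= T)%O -> T = m.
Proof.
pose above := {X : niceSubalg A | (R <= X)%O}.
pose le_above (X Y : above) := (sval X <= sval Y)%O.
have [||||[m Rm] mmax] := @Zorn above le_above.
- by move=> X; exact: lexx.
- by move=> X Y Z; exact: le_trans.
- by move=> X Y XY YX; apply/val_inj/le_anti/andP.
- move=> C Ctot.
  have [[X0 CX0]|C0] := pselect (C !=set0); last first.
    (* the subtype supplies a bound for the empty chain, namely [R] *)
    by exists (exist _ R (lexx R)) => X CX; case: C0; exists X.
  have [||T CT] := @nice_directed_bound [set sval X | X in C].
  + by exists (sval X0), X0.
  + move=> _ _ [X CX <-] [Y CY <-]; case: (Ctot _ _ CX CY) => XY.
    * by exists (sval Y); split => //; exists Y.
    * by exists (sval X); split => //; exists X.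
  + have RT : (R <= T)%O.
      by apply: le_trans (svalP X0) _; apply: CT; exists X0.
    by exists (exist _ T RT) => X CX; apply: CT; exists X.
- exists m => // T mT.
  by have /(congr1 sval) := mmax (exist _ T (le_trans Rm mT)) mT.
Qed.

End NiceConstructions.

(** * The topology in terms of the order *)

Section NiceOrderTopology.
Context {S : idomainType} {A : algType {fraction S}}.
Implicit Types (R : niceSubalg A) (U G : set (niceSubalg A)).

(** An upper set is the union of the basic open sets indexed by its own
members. *)
Lemma open_upperP U :
  open U <-> forall x y, U x -> (x <= y)%O -> U y.
Proof.
split=> [[D _ <-] x y [M DM Mx] /le_niceE xy|Uup].
  exists M => //; have Mx' : niceV M x := Mx.
  suff : niceV M y by []; by move=> a /Mx' /xy.
exists [set nice_set x | x in U] => //.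
apply/seteqP; split=> [y [_ [x Ux <-] xy]|x Ux].
  by apply: Uup Ux _; apply/le_niceE.
by exists (nice_set x); [exists x | move=> a].
Qed.

Lemma closed_lowerP G :
  closed G <-> forall x y, G y -> (x <= y)%O -> G x.
Proof.
rewrite -openC open_upperP; split=> h x y.
- by move=> Gy xy; apply: contrapT => nGx; exact: h nGx xy Gy.
- by move=> nGx xy Gy; exact/nGx/h/xy.
Qed.

Lemma closure_lowerset U :
  closure U = [set x | exists2 y, U y & (x <= y)%O].
Proof.
apply/seteqP; split=> x.
- rewrite closureE; apply; split.
  + apply/closed_lowerP => y z [w Uw zw] yz.
    by exists w => //; exact: le_trans yz zw.
  + by move=> y Uy; exists y.
- move=> [y Uy xy]; have /closed_lowerP cl := closed_closure (A := U).
  exact/(cl _ y)/xy/subset_closure.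
Qed.

End NiceOrderTopology.

(** * The equivalences *)

Theorem theorem2p11 (S : idomainType) (A : algType {fraction S})
    (U : set (niceSubalg A)) :
  (exists s : S, s != 0 /\ s \isn't a GRing.unit) ->
  @base_field S A <> setT ->
  [set: niceSubalg A] !=set0 ->
  open U -> U !=set0 ->
  [<-> exists R, greatest U R;
       exists R0 : niceSubalg A, closure U = closure [set R0];
       exists! R, maximal_in U R;
       irreducible_set U;
       sup_subsemilattice U;
       forall H, H !=set0 -> H `<=` U -> exists R, isLub H R].
Proof.
move=> _ _ _ /open_upperP Uup U0; tfae.
- move=> [R [UR Rmax]]; exists R; rewrite !closure_lowerset.
  apply/seteqP; split=> x [y Uy xy].
  + by exists R => //; exact: le_trans xy (Rmax _ Uy).
  + by exists R => //; rewrite -Uy.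
- move=> [R0]; rewrite !closure_lowerset => clU.
  have leR0 x : U x -> (x <= R0)%O.
    move=> Ux; have : [set x | exists2 y, U y & (x <= y)%O] x by exists x.
    by rewrite clU => -[_ ->].
  have UR0 : U R0.
    have : [set x | exists2 y, [set R0] y & (x <= y)%O] R0 by exists R0.
    rewrite -clU => -[y Uy R0y]; suff -> : R0 = y by [].
    by apply/le_anti; rewrite R0y leR0.
  exists R0; split=> [|R [UR]].
  + by split=> // x Ux R0x; apply/le_anti; rewrite leR0.
  + by apply => //; exact: leR0.
- move=> [R [[UR _] Runiq]]; split=> // G1 G2.
  move=> /closed_lowerP c1 /closed_lowerP c2.
  have leR x : U x -> (x <= R)%O.
    move=> Ux; have [m xm mmax] := exists_maximal_above x.
    rewrite (Runiq m) //; split; first exact: Uup Ux xm.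
    by move=> y _; exact: mmax.
  move=> /(_ R UR) [GR|GR]; [left|right] => x /leR xR.
  + exact: c1 GR xR.
  + exact: c2 GR xR.
- move=> [_ Uirr] x y Ux Uy.
  have [z [Uz xz yz]] : exists z, [/\ U z, (x <= z)%O & (y <= z)%O].
    apply: contrapT => nz.
    have cl w : closed [set z : niceSubalg A | ~ (w <= z)%O].
      by apply/closed_lowerP => u v nwv uv wu; exact/nwv/(le_trans wu uv).
    case: (Uirr _ _ (cl x) (cl y)).
    + move=> z Uz /=; have [xz|] := pselect (x <= z)%O; last by left.
      by right=> yz; apply: nz; exists z.
    + by move=> /(_ _ Ux); apply.
    + by move=> /(_ _ Uy); apply.
  have [||s [sub smin]] := @bounded_isLub _ _ [set x; y] z.
  + by exists x; left.
  + by move=> _ [->|->].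
  + exists s; split=> [|w [_ wub]]; last exact: smin.
    by split=> //; apply: Uup Ux _; apply: sub; left.
- move=> Usup H H0 HU.
  have [//||T UT] := @nice_directed_bound _ _ U.
    move=> x y Ux Uy; have [s [[Us sub] _]] := Usup _ _ Ux Uy.
    by exists s; split=> //; apply: sub; [left | right].
  by apply: (bounded_isLub (T := T)) => // x /HU; exact: UT.
- move=> Ulub; have [R [Rub _]] := Ulub U U0 (@subset_refl _ U).
  have [x Ux] := U0; exists R; split => //.
  exact: Uup Ux (Rub _ Ux).
Qed.
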